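(* Let $m \geq 1$ be an integer and $B \in \mathbb{F}_2^{m\times m}$. Then the following are equivalent: (i) $t(I,B,B^2)=0$; (ii) there exists $L \in \mathcal{L}$ such that $B = L P J L^{-1}$. Moreover, if one of (i), (ii) holds, then $B^3 = I$.
   Context: $\mathbb{F}_2=\{0,1\}$ is the field with two elements and $\mathbb{F}_2^{m\times m}$ the set of $m\times m$ matrices over $\mathbb{F}_2$; $I=I_m$ is the identity matrix. For $C_1,\dots,C_s\in\mathbb{F}_2^{m\times m}$, the digital net generated by $(C_1,\dots,C_s)$ is the point set $\{\mathbf{x}_0,\dots,\mathbf{x}_{2^m-1}\}\subset[0,1)^s$ defined as follows: for $0\le l<2^m$ write $l=\iota_0+\iota_1 2+\dots+\iota_{m-1}2^{m-1}$ with $\iota_k\in\mathbb{F}_2$, put $\mathbf{y}_{l,j}=C_j(\iota_0,\dots,\iota_{m-1})^\top\in\mathbb{F}_2^m$ and $\mathbf{x}_l=(\phi(\mathbf{y}_{l,1}),\dots,\phi(\mathbf{y}_{l,s}))$, where $\phi((y_1,\dots,y_m)^\top)=\sum_{k=1}^m y_k 2^{-k}$. For $0\le t\le m$, a point set $\{\mathbf{x}_0,\dots,\mathbf{x}_{2^m-1}\}\subset[0,1)^s$ is a $(t,m,s)$-net over $\mathbb{F}_2$ if for all nonnegative integers $d_1,\dots,d_s$ with $d_1+\dots+d_s=m-t$, every elementary interval $\prod_{i=1}^s[a_i/2^{d_i},(a_i+1)/2^{d_i})$ with integers $0\le a_i<2^{d_i}$ contains exactly $2^t$ of the points (counted with multiplicity).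 $t(C_1,\dots,C_s)$ denotes the $t$-value of the digital net generated by $(C_1,\dots,C_s)$, i.e. the least $t$ for which it is a $(t,m,s)$-net over $\mathbb{F}_2$. $J=J_m$ is the $m\times m$ anti-diagonal matrix with all anti-diagonal entries $1$ (and all other entries $0$), and $P=P_m=\left(\binom{j-1}{i-1} \bmod 2\right)_{i,j=1}^m$ is the upper-triangular Pascal matrix reduced mod $2$. $\mathcal{L}$ denotes the set of non-singular lower-triangular $m\times m$ matrices over $\mathbb{F}_2$ (i.e. lower-triangular with all diagonal entries $1$). *)

(* Defs.v *)
From mathcomp Require Import all_boot all_order all_algebra.
From mathcomp Require Import boolp.

Set Implicit Arguments.
Unset Strict Implicit.
Unset Printing Implicit Defensive.

Import Order.TTheory GRing.Theory Num.Theory.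
Local Open Scope ring_scope.

(* Binary digits of [l], least significant first. *)
Definition digits (m l : nat) : 'cV['F_2]_m :=
  \col_(k < m) ((l %/ 2 ^ k) %% 2)%N%:R.

(* Indices start at 0, so the weight of [y k] is 2^-(k+1). All the points
   considered are dyadic, hence coordinates are taken in [rat]. *)
Definition phi (m : nat) (y : 'cV['F_2]_m) : rat :=
  \sum_(k < m) (nat_of_ord (y k 0))%:R / 2%:R ^+ k.+1.

Definition digital_net (m s : nat) (C : s.-tuple 'M['F_2]_m)
    (l : 'I_(2 ^ m)) (j : 'I_s) : rat :=
  phi (tnth C j *m digits m l).

Definition in_elementary_interval (s : nat) (d a : 'I_s -> nat)
    (x : 'I_s -> rat) : bool :=
  [forall i, (a i)%:R / 2%:R ^+ d i <= x i < (a i).+1%:R / 2%:R ^+ d i].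

(* Points are indexed by ['I_(2 ^ m)], so counting indices counts points with
   multiplicity. *)
Definition is_net (t m s : nat) (x : 'I_(2 ^ m) -> 'I_s -> rat) : Prop :=
  [/\ (t <= m)%N,
      forall l i, 0 <= x l i < 1 &
      forall d : 'I_s -> nat, (\sum_i d i = m - t)%N ->
      forall a : 'I_s -> nat, (forall i, (a i < 2 ^ d i)%N) ->
        #|[set l | in_elementary_interval d a (x l)]| = (2 ^ t)%N].

Lemma phi_itv (m : nat) (y : 'cV['F_2]_m) : 0 <= phi y < 1.
Proof.
apply/andP; split.
  by apply: sumr_ge0 => k _; rewrite divr_ge0 ?exprn_ge0 ?ler0n.
have geo : \sum_(k < m) (1 / 2%:R ^+ k.+1) = 1 - 1 / 2%:R ^+ m :> rat.
  elim: m {y} => [|m IH]; first by rewrite big_ord0 expr0 divr1 subrr.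
  rewrite big_ord_recr /= IH -addrA; congr (_ + _).
  have h : 1 / 2%:R ^+ m = 2%:R * (1 / 2%:R ^+ m.+1) :> rat.
    by rewrite !div1r exprS invfM mulVKf.
  by rewrite h mulr_natl mulr2n opprD addrNK.
apply: (@le_lt_trans _ _ (1 - 1 / 2%:R ^+ m)); last first.
  by rewrite ltrBlDr ltrDl divr_gt0 ?exprn_gt0 ?ltr0n.
rewrite -geo; apply: ler_sum => k _.
rewrite ler_pM2r ?invr_gt0 ?exprn_gt0 ?ltr0n //.
by rewrite -[leRHS]/(1%:R) ler_nat -ltnS (ltn_ord (y k 0)).
Qed.

Lemma digital_net_is_net_m (m s : nat) (C : s.-tuple 'M['F_2]_m) :
  is_net m (digital_net C).
Proof.
split=> // [l i|d]; first exact: phi_itv.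
rewrite subnn => /eqP; rewrite sum_nat_eq0 => /forallP d0 a ltad.
rewrite (_ : [set l | _] = setT) ?cardsT ?card_ord //.
apply/setP => l; rewrite !inE; apply/forallP => i.
have di0 : d i = 0%N by apply/eqP; exact: (implyP (d0 i)).
have := ltad i; rewrite di0 expn0 ltnS leqn0 => /eqP ->.
by rewrite expr0 !divr1; exact: phi_itv.
Qed.

Lemma t_value_exists (m s : nat) (C : s.-tuple 'M['F_2]_m) :
  exists t, `[< is_net t (digital_net C) >].
Proof. by exists m; apply/asboolP; exact: digital_net_is_net_m. Qed.

Definition t_value (m s : nat) (C : s.-tuple 'M['F_2]_m) : nat :=
  ex_minn (t_value_exists C).

Definition antidiag_mx (m : nat) : 'M['F_2]_m :=
  \matrix_(i, j) ((i + j).+1 == m)%N%:R.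

(* With indices starting at 0, the entry is 'C(j, i); the cast to ['F_2]
   performs the reduction mod 2. *)
Definition pascal_mx (m : nat) : 'M['F_2]_m :=
  \matrix_(i, j) 'C(j, i)%:R.

(* [is_trig_mx] is lower-triangularity. *)
Definition nonsing_lower (m : nat) (L : 'M['F_2]_m) : bool :=
  is_trig_mx L && (L \in unitmx).

(* Main.v *)
(* For the matrices (I, B, B^2), t = 0 says that for d1 + d2 + d3 = m the first
   d1, d2, d3 rows of the three matrices form a basis, i.e. three full flags are
   in general position.  Over F_2 such a triple is unique up to a change of
   coordinates.  The first two flags are brought to the standard and the reversed
   one by a decomposition B = Y J V with Y, V lower-triangular.  The third flag is
   then spanned by the rows of the Pascal matrix P: normalised to be upper
   unitriangular, its first entry deviating from P would differ by 1, hence make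
   a minor on consecutive columns vanish, because all such minors of P equal 1.
   So B = Y J V and B^2 = Z P V; comparing both gives Y = V^-1 J P J, and
   J P is conjugate to P J by J P J since P^2 = J^2 = 1.  Finally
   P J P = J P J gives (P J)^3 = 1.  *)
Require Import Defs.
From mathcomp Require Import all_boot all_order all_algebra.
From mathcomp Require Import zify boolp.
Import Order.TTheory GRing.Theory Num.Theory.
Local Open Scope ring_scope.

Set Implicit Arguments.
Unset Strict Implicit.
Unset Printing Implicit Defensive.

(** * Lower-triangular matrices and general position *)

Section LowerTriangular.
Variables (F : fieldType) (m : nat).
Implicit Types (a : 'rV[F]_m) (A L : 'M[F]_m).

(** The products [a *m C] with such [a] are the combinations of the first [d] rows of [C]. *)
Definition supported_below d a := forall i : 'I_m, (d <= i)%N -> a 0 i = 0.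

Lemma supported_mul_trig d a A :
  is_trig_mx A -> supported_below d a -> supported_below d (a *m A).
Proof.
move=> /is_trig_mxP trA sa j dj; rewrite mxE big1 // => i _.
have [lt_ij|le_ji] := ltnP i j; first by rewrite trA ?mulr0.
by rewrite sa ?mul0r // (leq_trans dj).
Qed.

Lemma trig_unit_diag A i : is_trig_mx A -> A \in unitmx -> A i i != 0.
Proof.
by move=> trA; rewrite unitmxE unitfE det_trig // => /prodf_neq0; apply.
Qed.

(** If [i] is the position of the last nonzero entry of [a], then column [i] of [a *m A] is that
    entry times the nonzero [A i i]. *)
Lemma supported_mul_trigK d a A : is_trig_mx A -> A \in unitmx ->
  supported_below d (a *m A) -> supported_below d a.
Proof.
(* The bound [d + m] holds vacuously; each induction step lowers it by one. *)
move=> trA uA saA; suff sa n : supported_below (d + n) a -> supported_below d a.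
  by apply: (sa m) => i; have := ltn_ord i; lia.
elim: n => [|n IHn]; rewrite ?addn0 // addnS => sa; apply: IHn => i.
rewrite leq_eqVlt => /orP[/eqP di|]; last exact: sa.
have := saA i; rewrite -di leq_addr => /(_ isT) /eqP.
rewrite mxE (bigD1 i) //= big1 ?addr0 => [|j neq_ji].
  by rewrite mulf_eq0 (negPf (trig_unit_diag i trA uA)) orbF => /eqP.
have [lt_ji|le_ij] := ltnP j i; first by move/is_trig_mxP: trA => ->; rewrite ?mulr0.
by rewrite sa ?mul0r // di ltn_neqAle le_ij eq_sym (inj_eq val_inj) neq_ji.
Qed.

Lemma is_trig_rowP A :
  (forall i : 'I_m, supported_below i.+1 (row i A)) <-> is_trig_mx A.
Proof.
split=> [sA|/is_trig_mxP trA i j lt_ij]; last by rewrite mxE trA.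
by apply/is_trig_mxP => i j lt_ij; have := sA i j lt_ij; rewrite mxE.
Qed.

Lemma trig_mulmx A L : is_trig_mx A -> is_trig_mx L -> is_trig_mx (A *m L).
Proof.
move=> /is_trig_rowP trA trL; apply/is_trig_rowP => i.
by rewrite row_mul; apply: supported_mul_trig.
Qed.

Lemma trig_invmx A : is_trig_mx A -> A \in unitmx -> is_trig_mx (invmx A).
Proof.
move=> trA uA; apply/is_trig_rowP => i; apply: (supported_mul_trigK trA uA).
rewrite -row_mul mulVmx // => j lt_ij; rewrite !mxE; case: eqP => // ji.
by rewrite ji ltnn in lt_ij.
Qed.

End LowerTriangular.

Section NonsingLower.
Variable m : nat.
Implicit Types A L : 'M['F_2]_m.

Lemma nonsing_lowerM A L :
  nonsing_lower A -> nonsing_lower L -> nonsing_lower (A *m L).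
Proof.
move=> /andP[trA uA] /andP[trL uL].
by rewrite /nonsing_lower trig_mulmx // unitmx_mul uA.
Qed.

Lemma nonsing_lowerV A : nonsing_lower A -> nonsing_lower (invmx A).
Proof. by move=> /andP[trA uA]; rewrite /nonsing_lower trig_invmx // unitmx_inv. Qed.

Lemma nonsing_lower_diag A i : nonsing_lower A -> A i i = 1.
Proof.
move=> /andP[trA uA]; have := trig_unit_diag i trA uA.
by case: (A i i) => -[|[|//]] // ? _; apply/val_inj.
Qed.

End NonsingLower.

Section NetFree.
Variables (F : fieldType) (m : nat).

(** Independence of the first [d i] rows of all the [C i]. Coefficients are full-length vectors of
    bounded support, so that no type depends on [d]. *)
Definition net_free s (C : 'I_s -> 'M[F]_m) :=
  forall d : 'I_s -> nat, (\sum_i d i = m)%N ->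
  forall a : 'I_s -> 'rV_m, (forall i, supported_below (d i) (a i)) ->
  \sum_i a i *m C i = 0 -> forall i, a i = 0.

(* [pid_mx d : 'M_(d, m)] on the left selects the first [d] rows if [d <= m]. *)
Definition stack s (d : 'I_s -> nat) (C : 'I_s -> 'M[F]_m) :=
  \mxcol_i (pid_mx (d i) *m C i : 'M_(d i, m)).

Lemma supported_pid d (x : 'rV[F]_d) : supported_below d (x *m pid_mx d : 'rV_m).
Proof.
move=> i di; rewrite mxE big1 // => k _; rewrite mxE.
by rewrite [(k : nat) == i]ltn_eqF ?mulr0 // (leq_trans (ltn_ord k)).
Qed.

Lemma stack_free s d (C : 'I_s -> 'M[F]_m) :
  net_free C -> (\sum_i d i = m)%N -> row_free (stack d C).
Proof.
move=> freeC sum_d; apply: inj_row_free => x; rewrite -[x]submxrowK mul_mxrow_mxcol.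
move=> xS0; have {}xS0 : \sum_i (submxrow x i *m pid_mx (d i) : 'rV_m) *m C i = 0.
  by rewrite -[RHS]xS0; apply: eq_bigr => i _; rewrite -mulmxA.
have x0 := freeC _ sum_d _ (fun i => supported_pid _) xS0.
transitivity (\mxrow_i (0 : 'rV[F]_(d i))); last exact: mxrow0.
apply/eq_mxrowP => i.
have dm : (d i <= m)%N by rewrite -sum_d (bigD1 i) //= leq_addr.
have /(congr1 (fun y => y *m (pid_mx (d i) : 'M_(m, d i)))) := x0 i.
by rewrite /= -mulmxA mul_pid_mx minnn (minn_idPr dm) pid_mx_1 mulmx1 mul0mx.
Qed.

Lemma stack_full s d (C : 'I_s -> 'M[F]_m) :
  net_free C -> (\sum_i d i = m)%N -> row_full (stack d C).
Proof.
by move=> freeC sum_d; rewrite /row_full (eqP (stack_free freeC sum_d)) sum_d.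
Qed.

Lemma net_free_span s d (C : 'I_s -> 'M[F]_m) (v : 'rV_m) :
  net_free C -> (\sum_i d i = m)%N ->
  exists2 a : 'I_s -> 'rV_m,
    forall i, supported_below (d i) (a i) & v = \sum_i a i *m C i.
Proof.
move=> freeC sum_d; have /row_fullP[D DS] := stack_full freeC sum_d.
exists (fun i => submxrow (v *m D) i *m pid_mx (d i)) => [i|].
  exact: supported_pid.
transitivity (\mxrow_i submxrow (v *m D) i *m stack d C).
  by rewrite submxrowK -mulmxA DS mulmx1.
by rewrite mul_mxrow_mxcol; apply: eq_bigr => i _; rewrite mulmxA.
Qed.

Definition net_free3 (C1 C2 C3 : 'M[F]_m) :=
  forall d1 d2 d3, (d1 + d2 + d3 = m)%N ->
  forall a b c : 'rV_m, supported_below d1 a -> supported_below d2 b ->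
  supported_below d3 c -> a *m C1 + b *m C2 + c *m C3 = 0 ->
  [/\ a = 0, b = 0 & c = 0].

Lemma net_free3P (C1 C2 C3 : 'M[F]_m) :
  net_free (tnth [tuple C1; C2; C3]) <-> net_free3 C1 C2 C3.
Proof.
have sum3 (V : nmodType) (f : 'I_3 -> V) : \sum_i f i = f 0 + f 1 + f 2%:R.
  by rewrite !big_ord_recr big_ord0 /= add0r; congr (f _ + f _ + f _); apply: val_inj.
pose t T (x y z : T) (i : 'I_3) := tnth [tuple x; y; z] i.
split=> free => [d1 d2 d3 sum_d a b c sa sb sc abc0|d sum_d a sa a0 i].
  have sum_t : (\sum_i t _ d1 d2 d3 i = m)%N by rewrite (sum3 nat).
  have t0 : forall i, t _ a b c i = 0.
    apply: (free _ sum_t); last by rewrite sum3.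
    by case=> -[|[|[|//]]].
  by split; [apply: (t0 0) | apply: (t0 1) | apply: (t0 2%:R)].
rewrite (sum3 nat) in sum_d; rewrite sum3 in a0.
have [a00 a10 a20] := free _ _ _ sum_d _ _ _ (sa 0) (sa 1) (sa 2%:R) a0.
case: i => -[|[|[|//]]] lti; [rewrite -a00|rewrite -a10|rewrite -a20];
  congr a; exact: val_inj.
Qed.

Lemma net_free3_span C1 C2 C3 (d1 d2 d3 : nat) (v : 'rV_m) :
  net_free3 C1 C2 C3 -> (d1 + d2 + d3 = m)%N ->
  exists a b c : 'rV_m, [/\ supported_below d1 a, supported_below d2 b,
    supported_below d3 c & v = a *m C1 + b *m C2 + c *m C3].
Proof.
move=> /net_free3P free sum_d.
have [|a sa ->] := net_free_span (d := tnth [tuple d1; d2; d3]) v free.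
  by rewrite !big_ord_recr big_ord0.
exists (a 0), (a 1), (a 2%:R); split; [exact: (sa 0)|exact: (sa 1)|exact: (sa 2%:R)|].
rewrite !big_ord_recr big_ord0 /= add0r.
by congr (_ + _ + _); congr (_ *m _); congr a; apply: val_inj.
Qed.

Lemma net_free3_rot C1 C2 C3 : net_free3 C1 C2 C3 -> net_free3 C2 C3 C1.
Proof.
move=> free d1 d2 d3 sum_d a b c sa sb sc abc0.
have sum_d' : (d3 + d1 + d2 = m)%N by rewrite -sum_d; lia.
by case: (free _ _ _ sum_d' _ _ _ sc sa sb) => //; rewrite -addrA addrC.
Qed.

Lemma net_free3_mulmxr C1 C2 C3 M : M \in unitmx ->
  net_free3 C1 C2 C3 <-> net_free3 (C1 *m M) (C2 *m M) (C3 *m M).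
Proof.
move=> uM; split=> free d1 d2 d3 sum_d a b c sa sb sc abc0.
  apply: (free _ _ _ sum_d) => //; rewrite -[LHS](mulmxK uM).
  by rewrite [X in X *m _](_ : _ = 0) ?mul0mx // -abc0 !mulmxDl !mulmxA.
by apply: (free _ _ _ sum_d) => //; rewrite !mulmxA -!mulmxDl abc0 mul0mx.
Qed.

(** An invertible lower-triangular factor on the left preserves the span of the first [d] rows, for
    every [d]. *)
Lemma net_free3_mul_trig C1 C2 C3 L1 L2 L3 :
  is_trig_mx L1 -> is_trig_mx L2 -> is_trig_mx L3 ->
  L1 \in unitmx -> L2 \in unitmx -> L3 \in unitmx ->
  net_free3 C1 C2 C3 -> net_free3 (L1 *m C1) (L2 *m C2) (L3 *m C3).
Proof.
move=> tr1 tr2 tr3 u1 u2 u3 free d1 d2 d3 sum_d a b c sa sb sc abc0.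
have [||||a0 b0 c0] := free _ _ _ sum_d (a *m L1) (b *m L2) (c *m L3).
- exact: supported_mul_trig.
- exact: supported_mul_trig.
- exact: supported_mul_trig.
- by rewrite -!mulmxA.
by split; [rewrite -(mulmxK u1 a) a0|rewrite -(mulmxK u2 b) b0|
           rewrite -(mulmxK u3 c) c0]; rewrite mul0mx.
Qed.

End NetFree.

(** * From nets to general position *)

Section BinaryValue.

(** This is [2 ^ d * phi z] as a natural number; entry 0 is the most significant digit. *)
Definition binary_value d (z : 'cV['F_2]_d) : nat :=
  (\sum_(k < d) z k 0%R * 2 ^ (d - k.+1))%N.

Lemma ltn_F2 (x : 'F_2) : (nat_of_ord x < 2)%N.
Proof. exact: ltn_ord. Qed.

Lemma binary_value_recr d (z : 'cV['F_2]_d.+1) :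
  binary_value z =
    (2 * binary_value (\col_(k < d) z (widen_ord (leqnSn d) k) 0)%R + z ord_max 0%R)%N.
Proof.
rewrite /binary_value big_ord_recr /= subnn muln1 big_distrr /=; congr (_ + _)%N.
apply: eq_bigr => k _; rewrite mxE mulnCA -expnS; congr (_ * 2 ^ _)%N.
by have := ltn_ord k; lia.
Qed.

Lemma binary_value_lt d (z : 'cV['F_2]_d) : (binary_value z < 2 ^ d)%N.
Proof.
elim: d z => [|d IHd] z; first by rewrite /binary_value big_ord0.
rewrite binary_value_recr expnS.
have := IHd (\col_(k < d) z (widen_ord (leqnSn d) k) 0).
by have := ltn_F2 (z ord_max 0); lia.
Qed.

Lemma binary_value_inj d : injective (@binary_value d).
Proof.
elim: d => [|d IHd] z t; first by move=> _; apply/matrixP => -[].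
rewrite !binary_value_recr => eq_zt.
have := ltn_F2 (z ord_max 0); have := ltn_F2 (t ord_max 0) => ltz ltt.
have eq_max : z ord_max 0 = t ord_max 0 by apply: ord_inj; lia.
have /IHd/matrixP eq_widen : binary_value (\col_(k < d) z (widen_ord (leqnSn d) k) 0) =
    binary_value (\col_(k < d) t (widen_ord (leqnSn d) k) 0) by lia.
apply/colP => i; have [->//|] := eqVneq i ord_max.
rewrite -val_eqE => /= neq_i.
have lt_id : (i < d)%N by have := ltn_ord i; lia.
by have := eq_widen (Ordinal lt_id) 0; rewrite !mxE (_ : widen_ord _ _ = i) //; apply: val_inj.
Qed.

Lemma card_F2_col d : #|{: 'cV['F_2]_d}| = (2 ^ d)%N.
Proof. by rewrite card_mx card_Fp // muln1. Qed.

Lemma binary_value_onto d a : (a < 2 ^ d)%N -> exists z : 'cV['F_2]_d, binary_value z = a.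
Proof.
move=> lt_a; pose f z : 'I_(2 ^ d) := Ordinal (@binary_value_lt d z).
have inj_f : injective f by move=> z t [/binary_value_inj].
have [g _ fK] : bijective f by apply: inj_card_bij; rewrite // card_F2_col card_ord.
by exists (g (Ordinal lt_a)); have /(congr1 val) := fK (Ordinal lt_a).
Qed.

(** The last [e] digits contribute less than [2 ^ e], so the quotient keeps the first [d] digits. *)
Lemma binary_value_div d e (z : 'cV['F_2]_(d + e)) :
  (binary_value z %/ 2 ^ e)%N = binary_value (pid_mx d *m z : 'cV_d).
Proof.
rewrite {1}/binary_value big_split_ord /=.
have -> : (\sum_(i < d) z (lshift e i) 0%R * 2 ^ (d + e - i.+1) =
           binary_value (pid_mx d *m z : 'cV_d) * 2 ^ e)%N.
  rewrite big_distrl /=; apply: eq_bigr => i _; rewrite -mulnA -expnD.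
  congr (nat_of_ord _ * 2 ^ _)%N; last by have := ltn_ord i; lia.
  rewrite mxE (bigD1 (lshift e i)) //= big1 ?addr0 => [|k neq_ki].
    by rewrite mxE /= eqxx ltn_ord mul1r.
  rewrite mxE; case: eqP => [ik|]; last by rewrite mul0r.
  by case/eqP: neq_ki; apply: val_inj; rewrite /= -ik.
have -> : (\sum_(i < e) z (rshift d i) 0%R * 2 ^ (d + e - (d + i).+1) =
           binary_value (dsubmx z))%N.
  by apply: eq_bigr => i _; rewrite mxE; congr (_ * 2 ^ _)%N; lia.
by rewrite divnMDl ?expn_gt0 // divn_small ?addn0 // binary_value_lt.
Qed.

Lemma phiE m (z : 'cV['F_2]_m) : phi z = (binary_value z)%:R / 2%:R ^+ m.
Proof.
rewrite /phi natr_sum mulr_suml; apply: eq_bigr => k _.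
have <- : 2%:R ^+ (m - k.+1) * 2%:R ^+ k.+1 = 2%:R ^+ m :> rat.
  by rewrite -exprD subnK.
by rewrite natrM natrX [X in _ = _ / X]mulrC -mulf_div divff ?mulr1 // expf_neq0.
Qed.

Lemma phi_elementary_interval m d a (z : 'cV['F_2]_m) : (d <= m)%N ->
  (a%:R / 2%:R ^+ d <= phi z < a.+1%:R / 2%:R ^+ d) =
  (binary_value (pid_mx d *m z : 'cV_d) == a).
Proof.
move=> le_dm; rewrite phiE; move: z; rewrite -(subnKC le_dm) => z.
set e := (m - d)%N in z *.
rewrite -binary_value_div.
have scale b : b%:R / 2%:R ^+ d = (b * 2 ^ e)%:R / 2%:R ^+ (d + e) :> rat.
  by rewrite natrM natrX exprD -mulf_div divff ?mulr1 // expf_neq0.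
rewrite !scale ler_pM2r ?ltr_pM2r ?invr_gt0 ?exprn_gt0 // ler_nat ltr_nat.
have e_gt0 : (0 < 2 ^ e)%N by rewrite expn_gt0.
by rewrite -leq_divRL // -ltn_divLR // ltnS eq_sym eqn_leq.
Qed.

End BinaryValue.

Lemma digits_inj m (k l : nat) : (k < 2 ^ m)%N -> (l < 2 ^ m)%N ->
  digits m k = digits m l -> k = l.
Proof.
elim: m k l => [|m IHm] k l; first by rewrite expn0; lia.
rewrite expnS => ltk ltl /colP eq_kl.
have digit0 : (k %% 2 = l %% 2)%N.
  have := eq_kl ord0; rewrite !mxE expn0 !divn1 => /(congr1 val).
  by rewrite /= !val_Zp_nat // !modn_mod.
suff : (k %/ 2 = l %/ 2)%N by lia.
apply: IHm; [lia|lia|].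
apply/colP => i; have := eq_kl (lift ord0 i); rewrite !mxE.
by rewrite /bump /= expnS !divnMA.
Qed.

Lemma supported_pidK (F : fieldType) m d (a : 'rV[F]_m) : supported_below d a ->
  a *m (pid_mx d : 'M_(m, d)) *m (pid_mx d : 'M_(d, m)) = a.
Proof.
move=> sa; rewrite -mulmxA mul_pid_mx minnn; apply/rowP => j.
rewrite mxE (bigD1 j) //= big1 ?addr0 => [|k neq_kj].
  rewrite mxE eqxx /=; case: ltnP => [_|]; first exact: mulr1.
  by move=> le_j; rewrite sa ?mul0r //; have := ltn_ord j; lia.
by rewrite mxE -val_eqE in neq_kj *; rewrite (negPf neq_kj) mulr0.
Qed.

(** An elementary interval prescribes the first [d i] digits of each coordinate, that is, the image
    of the digit vector of [l] under the square matrix [stack d (tnth C)]. One point per interval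
    means that this matrix is bijective. *)
Lemma digital_netP m s (C : s.-tuple 'M['F_2]_m) :
  is_net 0 (digital_net C) <-> net_free (tnth C).
Proof.
have mem_interval d a (l : 'I_(2 ^ m)) : (\sum_i d i = m)%N ->
    in_elementary_interval d a (digital_net C l) =
    [forall i, binary_value (pid_mx (d i) *m (tnth C i *m digits m l) : 'cV_(d i)) == a i].
  move=> sum_d; apply: eq_forallb => i; apply: phi_elementary_interval.
  by rewrite -sum_d (bigD1 i) //= leq_addr.
split=> [[_ _ net] d sum_d a sa a0 i0|freeC].
  apply/rowP => k; rewrite mxE.
  (* The interval around [w] contains a point, whose coordinates share with [w] the first [d i]
     digits. Since [a i] sees only these, the relation [a0] gives that the sum of [a i *m w i] is
     zero, and this sum is entry [k] of [a i0]. *)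
  pose w i : 'cV['F_2]_m := if i == i0 then delta_mx k 0 else 0.
  pose b i := binary_value (pid_mx (d i) *m w i : 'cV_(d i)).
  have /eqP/cards1P[l] : #|[set l | in_elementary_interval d b (digital_net C l)]| = 1%N.
    by apply: net => [|i]; [rewrite subn0|apply: binary_value_lt].
  move/setP/(_ l); rewrite in_set1 eqxx inE mem_interval // => /forallP eq_l.
  have aw i : a i *m w i = a i *m tnth C i *m digits m l.
    rewrite -(supported_pidK (sa i)) -!mulmxA; congr (_ *m _).
    by rewrite (binary_value_inj (eqP (eq_l i))).
  have : \sum_i a i *m w i = 0.
    by under eq_bigr do rewrite aw; rewrite -mulmx_suml a0 mul0mx.
  rewrite (bigD1 i0) //= big1 => [|i /negPf neq_i]; last by rewrite /w neq_i mulmx0.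
  by rewrite /w eqxx addr0 -colE => /matrixP/(_ 0 0); rewrite !mxE.
split=> // [l i|d]; first exact: phi_itv.
rewrite subn0 => sum_d a lt_a.
have /fin_all_exists[t tE] i : exists t : 'cV['F_2]_(d i), binary_value t = a i.
  exact: binary_value_onto.
have /row_freeP[R SR] := stack_free freeC sum_d.
(* The right inverse [R] of the stack produces a vector with the prescribed digits; [digits] reaches
   it because it is injective between sets of equal size. *)
have [l lE] : exists l : 'I_(2 ^ m), digits m l = R *m \mxcol_i t i.
  pose f (l : 'I_(2 ^ m)) := digits m l.
  have inj_f : injective f by move=> k l /digits_inj eq_kl; apply/val_inj/eq_kl.
  have [g _ fK] : bijective f by apply: inj_card_bij; rewrite // card_F2_col card_ord.
  by exists (g (R *m \mxcol_i t i)); apply: fK.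
apply/eqP/cards1P; exists l; apply/setP => l'; rewrite !inE mem_interval //.
apply/forallP/eqP => [eq_a|-> i].
  suff eq_l : digits m l' = digits m l.
    exact/val_inj/(digits_inj (ltn_ord l') (ltn_ord l) eq_l).
  rewrite lE.
  apply: (row_full_inj (stack_full freeC sum_d)); rewrite mulmxA SR mul1mx.
  rewrite mxcol_mul; apply/eq_mxcolP => i; apply: binary_value_inj.
  by rewrite tE -mulmxA; apply/eqP.
have /(congr1 (mulmx (stack d (tnth C)))) := lE.
rewrite mulmxA SR mul1mx mxcol_mul => /eq_mxcolP/(_ i).
by rewrite -mulmxA => ->; rewrite tE.
Qed.

Lemma t_value_eq0 m s (C : s.-tuple 'M['F_2]_m) :
  t_value C = 0%N <-> net_free (tnth C).
Proof.
rewrite -digital_netP /t_value; case: ex_minnP => t /asboolP net_t min_t.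
split=> [<- //|net0]; apply/eqP; rewrite -leqn0; exact/min_t/asboolP.
Qed.

(** * The Pascal matrix *)

Section Antidiagonal.
Variable m : nat.
Local Notation J := (antidiag_mx m).

Lemma mul_antidiag n (A : 'M_(m, n)) i j : (J *m A) i j = A (rev_ord i) j.
Proof.
rewrite mxE (bigD1 (rev_ord i)) //= big1 ?addr0 => [|k neq_k].
  by rewrite mxE /= (_ : (_ == m) = true) ?mul1r //; have := ltn_ord i; lia.
rewrite mxE (_ : (_ == m) = false) ?mul0r //; apply: contraNF neq_k => /eqP ik.
by apply/eqP/val_inj => /=; lia.
Qed.

Lemma antidiag_mul n (A : 'M_(n, m)) i j : (A *m J) i j = A i (rev_ord j).
Proof.
have trJ : J^T = J by apply/matrixP => k l; rewrite !mxE addnC.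
by rewrite -[A *m J]trmxK trmx_mul trJ mxE mul_antidiag mxE.
Qed.

Lemma antidiag_antidiag : J *m J = 1%:M.
Proof.
apply/matrixP => i j; rewrite mul_antidiag !mxE /=; congr (nat_of_bool _)%:R.
by apply/eqP/eqP => [ij|->]; [apply/val_inj => /=|]; have := ltn_ord i; have := ltn_ord j; lia.
Qed.

End Antidiagonal.

Section Pascal.
Variable m : nat.
Local Notation J := (antidiag_mx m).
Local Notation P := (pascal_mx m).

Lemma coef_1DXn (R : comNzRingType) n i : ((1 + 'X : {poly R}) ^+ n)`_i = 'C(n, i)%:R.
Proof.
rewrite exprDn coef_sum.
under eq_bigr do rewrite expr1n mul1r coefMn coefXn.
have [le_in|lt_ni] := leqP i n; last first.
  by rewrite bin_small // big1 // => k _; rewrite gtn_eqF ?mul0rn // (leq_trans (ltn_ord k)).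
rewrite (bigD1 (Ordinal (le_in : i < n.+1)%N)) //= eqxx big1 ?addr0 // => k neq_k.
case: eqVneq => [ik|_]; last by rewrite mul0rn.
by case/eqP: neq_k; apply/val_inj.
Qed.

(** Puts the binomial theorem over the index range of a matrix product; the added binomials
    vanish. *)
Lemma exprDn_widen (R : comNzRingType) (x y : R) n N : (n < N)%N ->
  (x + y) ^+ n = \sum_(k < N) x ^+ (n - k) * y ^+ k *+ 'C(n, k).
Proof.
move=> lt_nN; rewrite exprDn.
rewrite (big_ord_widen N (fun k => x ^+ (n - k) * y ^+ k *+ 'C(n, k))) //.
rewrite [RHS](bigID (fun k : 'I_N => k < n.+1)%N) /= [X in _ + X]big1 ?addr0 // => k.
by rewrite -leqNgt => lt_nk; rewrite bin_small.
Qed.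

Lemma pchar2_poly : 2%N \in [pchar {poly 'F_2}].
Proof. by rewrite pchar_poly pchar_Fp. Qed.

(** Column [j] of [P] lists the coefficients of [(1 + 'X) ^+ j], and the substitution of [1 + 'X]
    for ['X] is an involution in characteristic 2. *)
Lemma pascal_pascal : P *m P = 1%:M.
Proof.
apply/matrixP => i j.
have : ((1 + (1 + 'X) : {poly 'F_2}) ^+ j)`_i = (j == i)%:R.
  by rewrite addrA (addrr_pchar2 pchar2_poly) add0r coefXn eq_sym.
rewrite (exprDn_widen _ _ (ltn_ord j)) coef_sum !mxE eq_sym => <-.
by apply: eq_bigr => k _; rewrite !mxE expr1n mul1r coefMn coef_1DXn mulr_natr.
Qed.

(** Both entries are the coefficient of degree [i] in [x1 ^+ (m - j.+1) * (x1 + 1) ^+ j] with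
    [x1 = 1 + 'X]: expanding the second factor gives the left side, and [x1 + 1 = 'X] gives the
    right side. *)
Lemma pascal_antidiag_pascal : P *m J *m P = J *m P *m J.
Proof.
apply/matrixP => i j; rewrite antidiag_mul mul_antidiag !mxE.
pose x1 : {poly 'F_2} := 1 + 'X.
have lt_jm := ltn_ord j; have lt_im := ltn_ord i.
have : (x1 ^+ (m - j.+1) * (x1 + 1) ^+ j)`_i = 'C(m - j.+1, m - i.+1)%:R.
  rewrite /x1 addrAC (addrr_pchar2 pchar2_poly) add0r coefMXn coef_1DXn.
  case: ltnP => [lt_ij|le_ji]; first by rewrite bin_small //; lia.
  by rewrite -bin_sub; [congr ('C(_, _)%:R)|]; lia.
move=> <-; rewrite (exprDn_widen _ _ lt_jm) mulr_sumr coef_sum.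
apply: eq_bigr => k _; rewrite antidiag_mul !mxE expr1n mulr1.
have [lt_jk|le_kj] := ltnP j k; first by rewrite (bin_small lt_jk) !(mulr0n, mulr0, coef0).
rewrite (mulrnAr (x1 ^+ _)) -exprD coefMn coef_1DXn mulr_natr /=.
by congr ('C(_, _)%:R *+ _); lia.
Qed.

Lemma pascal_antidiag_exp3 : P *m J *m (P *m J) *m (P *m J) = 1%:M.
Proof.
rewrite !mulmxA pascal_antidiag_pascal -!mulmxA (mulmxA J J) antidiag_antidiag.
by rewrite mul1mx (mulmxA P P) pascal_pascal mul1mx antidiag_antidiag.
Qed.

End Pascal.

(** Independence of the first [k] Pascal rows on [k] consecutive columns. Subtracting consecutive
    equations removes [c 0] and, by Pascal's rule, leaves the same system for the shifted
    coefficients. *)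
Lemma binomial_combination0 (R : comPzRingType) (c : nat -> R) k a :
  (forall i, (i < k)%N -> \sum_(j < k) c j * 'C(a + i, j)%:R = 0) ->
  forall j, (j < k)%N -> c j = 0.
Proof.
elim: k c => [//|k IHk] c c0.
have cS j : (j < k)%N -> c j.+1 = 0.
  apply: (IHk (fun j => c j.+1)) => i lt_ik.
  have := etrans (c0 i.+1 lt_ik) (esym (c0 i (leqW lt_ik))).
  rewrite !big_ord_recl !bin0 => /addrI.
  under eq_bigr do rewrite addnS binS natrD mulrDr.
  by rewrite big_split /= -[X in _ = X -> _]addr0 => /addrI.
case=> [_|j]; last exact: cS.
have := c0 0%N isT; rewrite big_ord_recl bin0 mulr1 big1 ?addr0 // => j _.
by rewrite cS ?mul0r.
Qed.

(** * Uniqueness of the third flag *)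

Lemma addrr_F2 (x : 'F_2) : x + x = 0.
Proof. exact: (addrr_pchar2 (pchar_Fp _)). Qed.

Lemma F2_neq0 (x : 'F_2) : x != 0 -> x = 1.
Proof. by case: x => -[|[|//]] // ? _; apply: val_inj. Qed.

Lemma row_delta m (i j : 'I_m) : (delta_mx 0 i : 'rV['F_2]_m) 0 j = (j == i :> nat)%:R.
Proof. by rewrite mxE eqxx. Qed.

Section Uniqueness.
Variable m : nat.
Local Notation J := (antidiag_mx m).
Local Notation P := (pascal_mx m).

Lemma antidiag_unit : J \in unitmx.
Proof. by case: (mulmx1_unit (antidiag_antidiag m)). Qed.

(** The [i]-th unit vector is expanded in the first [i] unit vectors and the first [m - i] rows of
    [B]; the two parts supply the rows of [V] and [Y] in [Y *m B = J *m V]. *)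
Lemma net_free3_LU (B C : 'M['F_2]_m) : net_free3 1%:M B C ->
  exists Y V, [/\ nonsing_lower Y, nonsing_lower V & B = Y *m J *m V].
Proof.
move=> free.
have /fin_all_exists[f fP] (i : 'I_m) : exists ab : 'rV['F_2]_m * 'rV['F_2]_m,
    [/\ supported_below i ab.1, supported_below (m - i) ab.2 &
        delta_mx 0 i - ab.1 = ab.2 *m B].
  have sum_m : (i + (m - i) + 0 = m)%N by have := ltn_ord i; lia.
  have [a [b [c [sa sb sc ->]]]] := net_free3_span (delta_mx 0 i) free sum_m.
  have c0 : c = 0 by apply/rowP => j; rewrite sc ?mxE.
  by exists (a, b); split=> //=; rewrite c0 mulmx1 mul0mx addr0 addrC addKr.
(* Reversing the index makes [Y] lower-triangular: the coefficients for [rev_ord i] are supported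
   below [m - (m - i.+1) = i.+1]. *)
pose V := \matrix_i (delta_mx 0 i - (f i).1); pose Y := \matrix_i (f (rev_ord i)).2.
have YBE : Y *m B = J *m V.
  apply/row_matrixP => i; rewrite row_mul rowK; have [_ _ <-] := fP (rev_ord i).
  rewrite -(rowK (fun i => delta_mx 0 i - (f i).1)).
  by apply/rowP => j; rewrite [RHS]mxE mul_antidiag mxE.
have trV : is_trig_mx V.
  apply/is_trig_rowP => i j lt_ij; rewrite rowK mxE row_delta gtn_eqF // mxE add0r.
  by have [sa _ _] := fP i; rewrite sa ?oppr0 // ltnW.
have uV : V \in unitmx.
  rewrite unitmxE det_trig // big1 ?unitr1 // => i _; rewrite 2!mxE row_delta eqxx mxE.
  by have [sa _ _] := fP i; rewrite sa // subr0.
have trY : is_trig_mx Y.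
  apply/is_trig_rowP => i; rewrite rowK; have [_ sb _] := fP (rev_ord i).
  by move=> j lt_ij; apply: sb => /=; have := ltn_ord i; lia.
have uY : Y \in unitmx.
  have : Y *m B \in unitmx by rewrite YBE unitmx_mul antidiag_unit.
  by rewrite unitmx_mul => /andP[].
clearbody V Y; exists (invmx Y), V; split; [|by rewrite /nonsing_lower trV|].
  by apply: nonsing_lowerV; rewrite /nonsing_lower trY.
by rewrite -mulmxA -YBE mulKmx.
Qed.

(** The first two terms vanish on the [d3] columns from [d1] on, so [c *m P] vanishes on consecutive
    columns and [binomial_combination0] gives [c = 0]. The remaining two terms have disjoint
    supports. *)
Lemma net_free3_antidiag_pascal : net_free3 1%:M J P.
Proof.
move=> d1 d2 d3 sum_d a b c sa sb sc; rewrite mulmx1 => abc0.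
have abc0E i : a 0 i + b 0 (rev_ord i) + (c *m P) 0 i = 0.
  by have /rowP/(_ i) := abc0; rewrite mxE [X in X + _]mxE antidiag_mul [RHS]mxE.
have c0 : c = 0.
  (* Extension of [c] by zero to all natural indices. *)
  pose c' n := oapp (c 0) 0 (insub n).
  have c'E (j : 'I_m) : c' j = c 0 j by rewrite /c' valK.
  have c'0 := @binomial_combination0 _ c' d3 d1.
  apply/rowP => j; rewrite mxE; have [le_dj|lt_jd] := leqP d3 j; first exact: sc.
  rewrite -c'E c'0 // => i lt_id.
  have lt_im : (d1 + i < m)%N by lia.
  have := abc0E (Ordinal lt_im); rewrite sa ?sb /=; [|lia|lia].
  rewrite !add0r => cP0; rewrite -[RHS]cP0 mxE.
  rewrite (big_ord_widen m (fun j => c' j * 'C(d1 + i, j)%:R)); last by lia.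
  rewrite [RHS](bigID (fun j : 'I_m => j < d3)%N) /= [X in _ = _ + X]big1 ?addr0.
    by apply: eq_bigr => k _; rewrite c'E mxE.
  by move=> k; rewrite -leqNgt => le_dk; rewrite sc ?mul0r.
split=> //; apply/rowP => i; rewrite mxE.
  have [le_di|lt_id] := leqP d1 i; first exact: sa.
  have := abc0E i; rewrite c0 mul0mx [X in _ + X]mxE addr0 sb ?addr0 //=.
  by have := ltn_ord i; lia.
have [le_di|lt_id] := leqP d2 i; first exact: sb.
have := abc0E (rev_ord i).
rewrite c0 mul0mx [X in _ + X]mxE addr0 rev_ordK sa ?add0r //=.
by have := ltn_ord i; lia.
Qed.

Lemma pascal_unique (U : 'M['F_2]_m) :
  nonsing_lower (J *m U *m J) -> net_free3 1%:M J U -> U = P.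
Proof.
move=> lowU freeU.
have UE i j : U i j = (J *m U *m J) (rev_ord i) (rev_ord j).
  by rewrite antidiag_mul mul_antidiag !rev_ordK.
have U_up (i j : 'I_m) : (j < i)%N -> U i j = 0.
  case/andP: lowU => /is_trig_mxP trU _ lt_ji; rewrite UE trU //=.
  by have := ltn_ord i; lia.
suff eqU n l (k j : 'I_m) : k = n :> nat -> j = l :> nat -> U k j = P k j.
  by apply/matrixP => k j; apply: eqU.
(* Rows are taken in increasing order and columns from left to right, so [(k, j)] is the first
   possible deviation. *)
elim/ltn_ind: n l k j => n IHn; elim/ltn_ind=> l IHl k j kn jl.
have {IHn}eq_rows (k' i : 'I_m) : (k' < k)%N -> U k' i = P k' i.
  by rewrite kn => lt_k'; apply: (IHn _ lt_k').
have {IHl}eq_cols (i : 'I_m) : (i < j)%N -> U k i = P k i.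
  by rewrite jl => lt_ij; apply: (IHl _ lt_ij).
have lt_jm := ltn_ord j; have lt_km := ltn_ord k.
have [lt_jk|le_kj] := ltnP j k; first by rewrite U_up // mxE bin_small.
apply/eqP; apply: contraT; rewrite -subr_eq0 => /F2_neq0 UP1.
have sum_m : (j - k + (m - j.+1) + k.+1 = m)%N by lia.
(* [c *m P] vanishes on the columns [j - k, j) and equals 1 in column j. *)
have [a [b [c [sa sb sc ej]]]] :=
  net_free3_span (delta_mx 0 j) net_free3_antidiag_pascal sum_m.
(* Otherwise [c] involves only [k] rows of [P]. The [j]-th unit vector is row [rev_ord j] of [J], so
   allowing one more row of [J] yields a nontrivial relation among [j - k], [m - j] and [k] rows. *)
have ck1 : c 0 k = 1.
  apply: F2_neq0; apply/eqP => ck0.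
  have sc' : supported_below k c.
    by move=> i; rewrite leq_eqVlt => /orP[/eqP/val_inj <- //|]; apply: sc.
  have sb' : supported_below (m - j) (b - delta_mx 0 (rev_ord j)).
    move=> i le_i; rewrite 2!mxE row_delta sb ?sub0r /=; last by lia.
    by rewrite gtn_eqF ?oppr0 //; lia.
  have move_right (x y z w : 'rV['F_2]_m) : x + (y - w) + z = x + y + z - w.
    by rewrite addrA (addrAC (x + y)).
  have sum_m' : (j - k + (m - j) + k = m)%N by lia.
  have [|_ b_ej _] := net_free3_antidiag_pascal sum_m' sa sb' sc'.
    rewrite mulmxBl (_ : delta_mx 0 (rev_ord j) *m J = delta_mx 0 j).
      by rewrite move_right; apply/eqP; rewrite subr_eq0 eq_sym; apply/eqP.
    apply/rowP => i; rewrite antidiag_mul !row_delta.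
    by rewrite !val_eqE (inj_eq rev_ord_inj).
  have /rowP/(_ (rev_ord j)) := b_ej.
  rewrite mxE [X in _ + X]mxE row_delta eqxx sb // sub0r [RHS]mxE => /eqP.
  by rewrite oppr_eq0 oner_eq0.
(* Hence [c *m U] vanishes on the columns [j - k, j], against [freeU]. *)
pose s := delta_mx 0 j + c *m (U - P).
(* Rows before [k] agree, row [k] agrees up to column [j], and in column [j] the two ones cancel. *)
have s0 (i : 'I_m) : (i <= j)%N -> s 0 i = 0.
  move=> le_ij; rewrite mxE row_delta mxE (bigD1 k) //= big1 => [|k' neq_k'].
    rewrite ck1 mul1r addr0 2!mxE; move: le_ij; rewrite leq_eqVlt.
    case/orP=> [/eqP/val_inj ->|lt_ij]; first by rewrite eqxx UP1 addrr_F2.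
    by rewrite ltn_eqF // eq_cols // mxE subrr addr0.
  rewrite !mxE; have [lt_k'k|le_kk'] := ltnP k' k.
    by rewrite eq_rows // mxE subrr mulr0.
  by rewrite sc ?mul0r // ltn_neqAle eq_sym val_eqE neq_k' le_kk'.
(* Thus [s], which equals [a + b *m J + c *m U], is a combination of the first [m - j.+1] rows of
   [J], and moving it into the second term gives a relation. *)
have sb' : supported_below (m - j.+1) (b - s *m J).
  move=> i le_i; rewrite mxE [X in _ + X]mxE antidiag_mul s0 ?subr0; first exact: sb.
  by rewrite /=; have := ltn_ord i; lia.
have [|_ _ c0] := freeU _ _ _ sum_m _ _ _ sa sb' sc.
  have cancel (x y z w : 'rV['F_2]_m) : x + (y - (x + y + z + (w - z))) + w = 0.
    rewrite -(addrA (x + y)) (addrC z) subrK.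
    by rewrite addrA [in X in X + w]opprD addrA subrr add0r addNr.
  rewrite mulmxBl -mulmxA antidiag_antidiag /s ej mulmxBr !mulmx1.
  exact: (cancel a (b *m J) (c *m P) (c *m U)).
by move: ck1; rewrite c0 mxE => /eqP; rewrite eq_sym oner_eq0.
Qed.
End Uniqueness.

(** * The normal form of B and its order *)

Section Equivalence.
Variable m : nat.
Local Notation J := (antidiag_mx m).
Local Notation P := (pascal_mx m).
Implicit Types B L A : 'M['F_2]_m.

Lemma antidiagK n (A : 'M_(m, n)) : J *m (J *m A) = A.
Proof. by rewrite mulmxA antidiag_antidiag mul1mx. Qed.

Lemma pascalK n (A : 'M_(m, n)) : P *m (P *m A) = A.
Proof. by rewrite mulmxA pascal_pascal mul1mx. Qed.

(** Conjugation by [J] exchanges lower and upper triangularity, so [L] is diagonal, with ones over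
    F_2. *)
Lemma nonsing_lower_eq1 L :
  nonsing_lower L -> nonsing_lower (J *m L *m J) -> L = 1%:M.
Proof.
move=> lowL /andP[/is_trig_mxP up _]; apply/matrixP => i j; rewrite !mxE -val_eqE.
have [lt_ij|lt_ji|/val_inj ->] := ltngtP i j; last exact: nonsing_lower_diag.
  by case/andP: lowL => /is_trig_mxP ->.
have := up (rev_ord i) (rev_ord j); rewrite antidiag_mul mul_antidiag !rev_ordK.
by apply => /=; have := ltn_ord i; lia.
Qed.

Lemma nonsing_lower_pascalJ : nonsing_lower (J *m P *m J).
Proof.
apply/andP; split.
  apply/is_trig_mxP => i j lt_ij; rewrite antidiag_mul mul_antidiag mxE.
  by rewrite bin_small //=; have := ltn_ord j; lia.
suff /mulmx1_unit[] : J *m P *m J *m (J *m P *m J) = 1%:M by [].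
by rewrite -!mulmxA antidiagK pascalK antidiag_antidiag.
Qed.

Lemma net_free3_sqr_pascal B : net_free3 1%:M B (B *m B) ->
  exists2 L, nonsing_lower L & B = L *m P *m J *m invmx L.
Proof.
move=> freeB; have [Y [V [lowY lowV BE]]] := net_free3_LU freeB.
have [/andP[trY uY] /andP[trV uV]] := (lowY, lowV).
have /andP[trY' uY'] := nonsing_lowerV lowY.
have uV' : invmx V \in unitmx by rewrite unitmx_inv.
have tr1 : is_trig_mx (1%:M : 'M['F_2]_m) by apply: scalar_mx_is_trig.
have u1 := unitmx1 'F_2 m.
(* In the coordinates given by [invmx V], the flags of [1] and [B] become those of [1] and [J]; [C]
   carries the third flag. *)
have [C CE0] : exists C, C = B *m B *m invmx V by eexists.
have freeC : net_free3 1%:M J C.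
  have BVE : invmx Y *m (B *m invmx V) = J by rewrite BE mulmxK // mulKmx.
  have := net_free3_mul_trig trV trY' tr1 uV uY' u1
    ((net_free3_mulmxr _ _ _ uV').1 freeB).
  by rewrite BVE -CE0 !mul1mx mulmxV.
(* Rotation puts [J] first and right multiplication by [J] makes it the identity. The decomposition
   of [C *m J] then splits [C] into a lower-triangular factor and the upper-triangular
   [J *m Q *m J]. *)
have := (net_free3_mulmxr _ _ _ (antidiag_unit m)).1 (net_free3_rot freeC).
rewrite antidiag_antidiag => /net_free3_LU[Z [Q [lowZ lowQ CJE]]].
have CE : C = Z *m (J *m Q *m J).
  by rewrite -[C]mulmx1 -(antidiag_antidiag m) mulmxA CJE !mulmxA.
have /andP[trZ' uZ'] := nonsing_lowerV lowZ; have /andP[_ uZ] := lowZ.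
have QE : J *m Q *m J = P.
  apply: pascal_unique.
    by rewrite !mulmxA antidiag_antidiag mul1mx -mulmxA antidiag_antidiag mulmx1.
  have := net_free3_mul_trig tr1 tr1 trZ' u1 u1 uZ' freeC.
  by rewrite !mul1mx CE mulKmx.
have {}QE : Q = J *m P *m J by rewrite -QE -!mulmxA antidiagK antidiag_antidiag mulmx1.
have uVY : V *m Y \in unitmx by rewrite unitmx_mul uV.
have [W WE] : exists W, W = invmx Z *m Y by eexists.
(* Compares [B *m B = Z *m (J *m Q *m J) *m V] with the square of [Y *m J *m V]. It shows that
   [J *m W *m J] is lower-triangular, like [W] itself. *)
have QW : Q = J *m W *m J *m (V *m Y).
  have JQJ : J *m Q *m J = W *m (J *m (V *m (Y *m J))).
    transitivity (invmx Z *m (B *m B) *m invmx V).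
      by rewrite -(mulmxA _ (B *m B)) -CE0 CE mulKmx.
    by rewrite WE BE -!mulmxA (mulmxV uV) mulmx1.
  transitivity (J *m (J *m Q *m J) *m J).
    by rewrite -!mulmxA antidiagK antidiag_antidiag mulmx1.
  by rewrite JQJ -!mulmxA antidiag_antidiag mulmx1.
have W1 : W = 1%:M.
  apply: nonsing_lower_eq1; first by rewrite WE; apply/nonsing_lowerM/lowY/nonsing_lowerV.
  rewrite -(mulmxK uVY (J *m W *m J)) -QW.
  exact/nonsing_lowerM/nonsing_lowerV/nonsing_lowerM.
have /andP[_ uQ] := lowQ.
have QVY : Q = V *m Y by rewrite QW W1 mulmx1 antidiag_antidiag mul1mx.
(* By [QVY], [B] is the conjugate of [Q *m J] by [invmx V], and [QQJ] below says that [Q] conjugates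
   [Q *m J] to [P *m J]. *)
exists (invmx (Q *m V)); first by apply/nonsing_lowerV/nonsing_lowerM.
have QQJ : Q *m (Q *m J) = P *m J *m Q.
  by rewrite QE -!mulmxA !(antidiagK, pascalK, antidiag_antidiag, mulmx1).
have invQV : invmx (Q *m V) = invmx V *m invmx Q.
  have uQV : Q *m V \in unitmx by rewrite unitmx_mul uQ.
  rewrite -[RHS](mulmxK uQV) -[invmx V *m _ *m _]mulmxA mulKmx //.
  by rewrite mulVmx // mul1mx.
rewrite invmxK invQV -!mulmxA (mulmxA J) (mulmxA P) (mulmxA P) -QQJ -!mulmxA mulKmx //.
by rewrite QVY -mulmxA mulKmx // mulmxA.
Qed.

(** Right multiplication by [L *m Q], where [Q = J *m P *m J], turns the triple into [L *m Q],
    [L *m J], [L *m P], which has the same flags as [1], [J], [P]. *)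
Lemma net_free3_pascal_sqr B L : nonsing_lower L ->
  B = L *m P *m J *m invmx L -> net_free3 1%:M B (B *m B).
Proof.
move=> lowL BE; have /andP[trL uL] := lowL.
pose Q := J *m P *m J; have lowQ : nonsing_lower Q := nonsing_lower_pascalJ.
have /andP[trLQ uLQ] := nonsing_lowerM lowL lowQ.
have PJQ : P *m J *m Q = J by rewrite /Q -!mulmxA antidiagK pascalK.
have BLQ : B *m (L *m Q) = L *m J by rewrite BE -!mulmxA mulKmx // (mulmxA P) PJQ.
have BLJ : B *m (L *m J) = L *m P.
  by rewrite BE -!mulmxA mulKmx // antidiag_antidiag mulmx1.
apply/(net_free3_mulmxr _ _ _ uLQ); rewrite -(mulmxA B) !BLQ BLJ.
rewrite mul1mx -[L *m Q]mulmx1.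
exact: (net_free3_mul_trig trLQ trL trL uLQ uL uL (@net_free3_antidiag_pascal m)).
Qed.

Lemma pascal_conj_exp3 B L : L \in unitmx ->
  B = L *m P *m J *m invmx L -> B *m (B *m B) = 1%:M.
Proof.
move=> uL ->; have := congr1 (fun A => L *m A *m invmx L) (pascal_antidiag_exp3 m).
by rewrite mulmx1 (mulmxV uL) -!mulmxA !(mulKmx uL).
Qed.

End Equivalence.

Theorem theorem1 (m : nat) (hm : (1 <= m)%N) (B : 'M['F_2]_m) :
  (t_value [tuple 1%:M; B; B ^+ 2] = 0%N <->
   exists2 L : 'M['F_2]_m, nonsing_lower L &
     B = L *m pascal_mx m *m antidiag_mx m *m invmx L)
  /\
  (t_value [tuple 1%:M; B; B ^+ 2] = 0%N \/
   (exists2 L : 'M['F_2]_m, nonsing_lower L &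
     B = L *m pascal_mx m *m antidiag_mx m *m invmx L) ->
   B ^+ 3 = 1%:M).
Proof.
have net0P : t_value [tuple 1%:M; B; B ^+ 2] = 0%N <-> net_free3 1%:M B (B *m B).
  by rewrite t_value_eq0 net_free3P.
have netL : t_value [tuple 1%:M; B; B ^+ 2] = 0%N <->
    exists2 L : 'M['F_2]_m, nonsing_lower L &
      B = L *m pascal_mx m *m antidiag_mx m *m invmx L.
  rewrite net0P; split=> [|[L lowL BE]]; first exact: net_free3_sqr_pascal.
  exact: net_free3_pascal_sqr lowL BE.
split=> // netB; have [L /andP[_ uL] BE] : exists2 L : 'M['F_2]_m, nonsing_lower L &
    B = L *m pascal_mx m *m antidiag_mx m *m invmx L by case: netB => // /netL.
exact: pascal_conj_exp3 uL BE.
Qed.
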